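(* Let $n\ge2$, let $X_1,\dots,X_n$ be Banach spaces and $D_k\in\mathcal{B}(X_k)$, and assume that $D_s-\lambda$ satisfies the complements condition for all $2\le s\le n-1$ and all $\lambda\in\mathbb{C}$. Then for every $A\in\mathcal{B}_n$, $$\bigcup_{k=1}^n\sigma_{le}(D_k)=\sigma_{le}(T_n^d(A))\cup\Delta_1\cup\Delta_2,$$ where $$\Delta_1=\bigcup_{k=2}^{n}\Big\{\lambda:\ \alpha(D_k-\lambda)=\infty,\ \alpha(D_s-\lambda)<\infty\text{ for }2\le s\le k-1,\ \sum_{s=1}^{k-1}\beta(D_s-\lambda)=\infty\Big\}\cap\rho_{le}(D_1)$$ (for $k=2$ the condition on $2\le s\le k-1$ is vacuous), and $$\Delta_2=\bigcup_{k=1}^{n}\Big\{\lambda:\ \alpha(D_s-\lambda)<\infty\text{ for all }s=1,\dots,n,\ \text{and } \mathcal{R}(D_k-\lambda)\text{ is not (closed and) complemented}\Big\}.$$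
   Context: For a bounded operator $T$ between Banach spaces, $\alpha(T)=\dim\mathcal{N}(T)$, $\beta(T)=\operatorname{codim}\mathcal{R}(T)$, values in $\{0,1,\dots\}\cup\{\infty\}$, sums taken in this extended set. $T\in\mathcal{B}(X,Y)$ satisfies the complements condition if $\mathcal{N}(T)$ is topologically complemented in $X$ and $\overline{\mathcal{R}(T)}$ is topologically complemented in $Y$. $T$ is left Fredholm if $\alpha(T)<\infty$ and $\mathcal{R}(T)$ is closed and complemented; $\sigma_{le}(T)=\{\lambda\in\mathbb{C}:\lambda-T$ not left Fredholm$\}$, $\rho_{le}=\mathbb{C}\setminus\sigma_{le}$. $\mathcal{B}_n$ is the set of tuples $A=(A_{ij})_{1\le i<j\le n}$, $A_{ij}\in\mathcal{B}(X_j,X_i)$; $T_n^d(A)$ is the upper triangular operator matrix on $X_1\oplus\cdots\oplus X_n$ with diagonal $D_1,\dots,D_n$, entries $A_{ij}$ above the diagonal and zeros below. *)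

(* Defs.v *)
From HB Require Import structures.
From mathcomp Require Import all_boot all_order all_algebra.
From mathcomp Require Import all_classical all_reals all_analysis.
From mathcomp Require Import complex.
From Stdlib Require Import FunctionalExtensionality.

Set Implicit Arguments.
Unset Strict Implicit.
Unset Printing Implicit Defensive.

Import Order.TTheory GRing.Theory Num.Theory.
Local Open Scope classical_set_scope.
Local Open Scope ring_scope.

Section Notions.
Variable K : numDomainType.

Definition lin_indep (V : lmodType K) (m : nat) (v : 'I_m -> V) : Prop :=
  forall c : 'I_m -> K, \sum_(i < m) c i *: v i = 0 -> forall i, c i = 0.

Definition infinite_dim (V : lmodType K) (S : set V) : Prop :=
  forall m : nat, exists v : 'I_m -> V, (forall i, S (v i)) /\ lin_indep v.

Definition infinite_codim (V : lmodType K) (S : set V) : Prop :=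
  forall m : nat, exists v : 'I_m -> V,
    forall c : 'I_m -> K, S (\sum_(i < m) c i *: v i) -> forall i, c i = 0.

Definition lin_subspace (V : lmodType K) (S : set V) : Prop :=
  S 0 /\ forall (a : K) (x y : V), S x -> S y -> S (a *: x + y).

Definition complemented (V : preTopologicalLmodType K) (M : set V) : Prop :=
  lin_subspace M /\ closed M /\
  exists N : set V, lin_subspace N /\ closed N /\ M `&` N = [set 0] /\
    forall x : V, exists u w, M u /\ N w /\ x = u + w.

Definition null_space (V W : lmodType K) (f : V -> W) : set V := [set x | f x = 0].

Definition alpha_finite (V W : lmodType K) (f : V -> W) : Prop :=
  ~ infinite_dim (null_space f).
Definition alpha_infinite (V W : lmodType K) (f : V -> W) : Prop :=
  infinite_dim (null_space f).
Definition beta_infinite (V W : lmodType K) (f : V -> W) : Prop :=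
  infinite_codim (range f).

Definition left_fredholm (V W : preTopologicalLmodType K) (f : V -> W) : Prop :=
  alpha_finite f /\ complemented (range f).

Definition complements_condition (V W : preTopologicalLmodType K) (f : V -> W)
  : Prop := complemented (null_space f) /\ complemented (closure (range f)).

Definition lam_minus (V : lmodType K) (T : V -> V) (lam : K) : V -> V :=
  fun x => lam *: x - T x.

Definition sigma_le (V : preTopologicalLmodType K) (T : V -> V) : set K :=
  [set lam | ~ left_fredholm (lam_minus T lam)].

End Notions.

(* Finite direct sum X_1 (+) ... (+) X_n, with componentwise linear    *)
(* structure and the product topology (= norm topology for finite sums *)
(* of normed spaces).                                                   *)
Section DirectSum.
Variables (K : numDomainType) (I : Type) (X : I -> preTopologicalLmodType K).

Definition dsum := forall i, X i.

HB.instance Definition _ :=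
  Topological.copy dsum (prod_topology (fun i => (X i : topologicalType))).

Definition dsum_zero : dsum := fun i => 0.
Definition dsum_add (x y : dsum) : dsum := fun i => x i + y i.
Definition dsum_opp (x : dsum) : dsum := fun i => - x i.
Definition dsum_scale (a : K) (x : dsum) : dsum := fun i => a *: x i.

Lemma dsum_addA : associative dsum_add.
Proof. by move=> x y z; apply: functional_extensionality_dep => i; rewrite /dsum_add addrA. Qed.
Lemma dsum_addC : commutative dsum_add.
Proof. by move=> x y; apply: functional_extensionality_dep => i; rewrite /dsum_add addrC. Qed.
Lemma dsum_add0 : left_id dsum_zero dsum_add.
Proof. by move=> x; apply: functional_extensionality_dep => i; rewrite /dsum_add add0r. Qed.
Lemma dsum_addN : left_inverse dsum_zero dsum_opp dsum_add.
Proof. by move=> x; apply: functional_extensionality_dep => i; rewrite /dsum_add /dsum_opp addNr. Qed.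

HB.instance Definition _ := GRing.isZmodule.Build dsum
  dsum_addA dsum_addC dsum_add0 dsum_addN.

Lemma dsum_scaleA a b (x : dsum) :
  dsum_scale a (dsum_scale b x) = dsum_scale (a * b) x.
Proof. by apply: functional_extensionality_dep => i; rewrite /dsum_scale scalerA. Qed.
Lemma dsum_scale1 : left_id 1 dsum_scale.
Proof. by move=> x; apply: functional_extensionality_dep => i; rewrite /dsum_scale scale1r. Qed.
Lemma dsum_scaleDr : right_distributive dsum_scale +%R.
Proof.
by move=> a x y; apply: functional_extensionality_dep => i;
  rewrite /dsum_scale /= /dsum_add scalerDr.
Qed.
Lemma dsum_scaleDl (x : dsum) :
  {morph dsum_scale^~ x : a b / a + b}.
Proof.
by move=> a b; apply: functional_extensionality_dep => i;
  rewrite /dsum_scale /= /dsum_add scalerDl.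
Qed.

HB.instance Definition _ := GRing.Zmodule_isLmodule.Build K dsum
  dsum_scaleA dsum_scale1 dsum_scaleDr dsum_scaleDl.

End DirectSum.

Definition upper_tri (K : numDomainType) (n : nat)
  (X : 'I_n -> preTopologicalLmodType K)
  (D : forall k, X k -> X k) (A : forall i j : 'I_n, X j -> X i)
  : dsum X -> dsum X :=
  fun x i => D i (x i) + \sum_(j < n | (i < j)%N) A i j (x j).

(* Main.v *)
Require Import Defs.
From HB Require Import structures.
From mathcomp Require Import all_boot all_order all_algebra.
From mathcomp Require Import all_classical all_reals all_analysis.
From mathcomp Require Import complex.
From mathcomp Require Import ring lra.

Set Implicit Arguments.
Unset Strict Implicit.
Unset Printing Implicit Defensive.

Import Order.TTheory GRing.Theory Num.Theory.
Import ComplexField.Normc.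
Local Open Scope classical_set_scope.
Local Open Scope ring_scope.

(** The range of [T - lam] is studied through one-sided inverses modulo finite rank:
    [f] is left Fredholm iff some bounded [S] satisfies [S f = 1 - F] with [F] of finite
    rank.  If every diagonal entry has such an inverse [S_k], then
    [diag(S_k) T = 1 - F + U] with [U] strictly upper triangular; multiplying by [1 - U]
    replaces [U] by [- U^2], so after finitely many steps [U] vanishes and [T] is left
    Fredholm.  Conversely a left inverse of [T] compresses to one of [D_1], because the
    first column of [T] is [(D_1, 0, ..., 0)].  Finally, if [alpha(D_k)] is infinite and
    [beta(D_s)] is finite for all [s < k], then [T] maps [X_1 + ... + X_(k-1)] onto a
    subspace of finite codimension, so all but finitely many dimensions of [ker D_k] lift
    to [ker T]; hence [T] is not left Fredholm.  Taking [k] minimal with [alpha(D_k)]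
    infinite gives the theorem.  The analytic inputs are the closed graph theorem
    (bounded left inverses) and the Hahn-Banach theorem (finite-dimensional subspaces are
    complemented). *)

(** * Complete norms inducing a given topology, and bounded maps *)

Section BanachNorms.
Variable R : realType.
Local Notation C := R[i].
Local Notation "r %:C" := (real_complex R r) : ring_scope.

Lemma normc_ge0 (a : C) : 0 <= normc a.
Proof. by case: a => a b; exact: sqrtr_ge0. Qed.

Lemma normc_real (r : R) : normc r%:C = `|r|.
Proof. by rewrite /= expr0n /= addr0 sqrtr_sqr. Qed.

(* The direct sum [dsum] carries a topology and a linear structure but no norm; a [bnorm]
   equips such a space with a real-valued norm that is complete and induces the topology.
   Completeness is required for geometrically converging sequences only. *)
Record bnorm (V : preTopologicalLmodType C) := BNorm {
  nrm :> V -> R ;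
  nrmD : forall x y, nrm (x + y) <= nrm x + nrm y ;
  nrmZ : forall a x, nrm (a *: x) = normc a * nrm x ;
  nrm_eq0 : forall x, nrm x = 0 -> x = 0 ;
  nrm_nbhs : forall x A,
    nbhs x A <-> exists2 e, 0 < e & forall y, nrm (y - x) < e -> A y ;
  nrm_complete : forall (u : nat -> V) (c : R),
    (forall k, nrm (u k.+1 - u k) <= c * 2^-1 ^+ k) ->
    exists l, forall e, 0 < e -> exists m, forall k, (m <= k)%N -> nrm (u k - l) < e }.

Section Norm.
Variables (V : preTopologicalLmodType C) (N : bnorm V).

Lemma nrm0 : N 0 = 0.
Proof. by rewrite -(scale0r (0 : V)) nrmZ (normc_real 0) normr0 mul0r. Qed.

Lemma nrmN x : N (- x) = N x.
Proof.
by rewrite -scaleN1r nrmZ normcN normc1 mul1r.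
Qed.

Lemma nrm_ge0 x : 0 <= N x.
Proof. by have := nrmD N x (- x); rewrite subrr nrm0 nrmN; lra. Qed.

Lemma nrm_sub x y : N (x - y) <= N x + N y.
Proof. by rewrite -(nrmN y); exact: nrmD. Qed.

Lemma nrm_dist x y : N (x - y) = N (y - x).
Proof. by rewrite -nrmN opprB. Qed.

Lemma nrm_tri z x y : N (x - y) <= N (x - z) + N (z - y).
Proof. by rewrite -[x - y](subrKA z); exact: nrmD. Qed.

Lemma nrmZR (r : R) x : N (r%:C *: x) = `|r| * N x.
Proof. by rewrite nrmZ normc_real. Qed.

Lemma nrm_gt0 x : x <> 0 -> 0 < N x.
Proof.
by move=> x0; rewrite lt_neqAle nrm_ge0 andbT eq_sym; apply/eqP => /nrm_eq0.
Qed.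

Lemma closed_nrmP (S : set V) : closed S <->
  forall x, (forall e, 0 < e -> exists2 y, S y & N (y - x) < e) -> S x.
Proof.
split=> [cS x Sx|H x Sx].
  apply: cS => B /(nrm_nbhs N)[e e0 eB]; have [y Sy ye] := Sx e e0.
  by exists y; split=> //; exact: eB.
apply: H => e e0; have [|y [Sy ye]] := Sx [set y | N (y - x) < e].
  by apply/(nrm_nbhs N); exists e.
by exists y.
Qed.

(** Rescaling [x] to norm [r / 2] reduces the estimate to the ball of radius [r]. As [c] may be
    nonpositive, its absolute value plus 1 replaces it to keep the constant positive. *)
Lemma homogeneous_bounded (p : V -> R) (r c : R) : 0 < r ->
  (forall t x, 0 < t -> p (t%:C *: x) = t * p x) -> p 0 <= 0 ->
  (forall x, N x < r -> p x <= c) -> exists2 k, 0 < k & forall x, p x <= k * N x.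
Proof.
move=> r0 pZ p0 pc; exists (2 * (`|c| + 1) / r).
  by rewrite divr_gt0// mulr_gt0// ltr_wpDl.
move=> x; have [->|x0] := pselect (x = 0); first by rewrite nrm0 mulr0.
have Nx := nrm_gt0 x0; pose t := r / (2 * N x).
have t0 : 0 < t by rewrite divr_gt0// mulr_gt0.
have : p (t%:C *: x) <= `|c| + 1.
  rewrite (@le_trans _ _ c)//; last by rewrite (le_trans (ler_norm c))// lerDl.
  apply: pc; rewrite nrmZR gtr0_norm// /t.
  have -> : r / (2 * N x) * N x = r / 2 by field; rewrite gt_eqF.
  lra.
rewrite pZ// => tp; rewrite -(ler_pM2l t0) (le_trans tp)//.
by rewrite le_eqVlt; apply/orP; left; apply/eqP; rewrite /t; field; rewrite !gt_eqF.
Qed.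

End Norm.

(** The norms are plain functions, so that scalar functionals measured by [normc] are covered
    too. *)
Definition bounded (V W : lmodType C) (N : V -> R) (M : W -> R) (f : V -> W) :=
  exists2 c, 0 <= c & forall x, M (f x) <= c * N x.

Lemma bounded_comp (U V W : lmodType C) (L : U -> R) (N : V -> R) (M : W -> R)
    (f : V -> W) (g : U -> V) :
  bounded N M f -> bounded L N g -> bounded L M (f \o g).
Proof.
move=> [c c0 fc] [k k0 gk]; exists (c * k); first exact: mulr_ge0.
by move=> x; rewrite (le_trans (fc _))// -mulrA ler_wpM2l.
Qed.

Section Bounded.
Variables (V W : preTopologicalLmodType C) (N : bnorm V) (M : bnorm W).

Lemma continuous_bounded (f : {linear V -> W}) : continuous f -> bounded N M f.
Proof.
move=> cf; have /(nrm_nbhs N)[r r0 rP] : nbhs (0 : V) (f @^-1` [set y | M y < 1]).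
  apply: cf; apply/(nrm_nbhs M); exists 1 => // y /=.
  by rewrite linear0 subr0.
have [|||k k0 kP] := @homogeneous_bounded _ N (fun x => M (f x)) r 1 r0.
- by move=> t x t0; rewrite linearZ/= nrmZR gtr0_norm.
- by rewrite linear0 nrm0.
- by move=> x xr; apply/ltW/rP; rewrite subr0.
by exists k => //; exact: ltW.
Qed.

Lemma bounded_add (f g : V -> W) :
  bounded N M f -> bounded N M g -> bounded N M (f \+ g).
Proof.
move=> [c c0 fc] [k k0 gk]; exists (c + k); first exact: addr_ge0.
by move=> x; rewrite (le_trans (nrmD M _ _))// mulrDl lerD.
Qed.

Lemma bounded_sub (f g : V -> W) :
  bounded N M f -> bounded N M g -> bounded N M (f \- g).
Proof.
move=> [c c0 fc] [k k0 gk]; exists (c + k); first exact: addr_ge0.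
by move=> x; rewrite (le_trans (nrm_sub M _ _))// mulrDl lerD.
Qed.

Lemma bounded0 : bounded N M (fun=> 0).
Proof. by exists 0 => // x; rewrite nrm0 mul0r. Qed.

Lemma bounded_id : bounded N N id.
Proof. by exists 1 => // x; rewrite mul1r. Qed.

Lemma bounded_rank1 (phi : V -> C) (w : W) : bounded (W := C^o) N (@normc R) phi ->
  bounded N M (fun x => phi x *: w).
Proof.
move=> [c c0 cP]; exists (c * M w); first by rewrite mulr_ge0 ?nrm_ge0.
by move=> x; rewrite nrmZ mulrAC ler_wpM2r ?nrm_ge0.
Qed.

Lemma bounded_approx (f : {linear V -> W}) x e : bounded N M f -> 0 < e ->
  exists2 d, 0 < d & forall y, N (y - x) < d -> M (f y - f x) < e.
Proof.
move=> [c c0 cP] e0; exists (e / (c + 1)); first by rewrite divr_gt0// ltr_wpDl.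
move=> y yx; rewrite -linearB (le_lt_trans (cP _))//.
rewrite (@le_lt_trans _ _ ((c + 1) * N (y - x)))//.
  by rewrite ler_wpM2r ?nrm_ge0// lerDl.
by rewrite mulrC -ltr_pdivlMr// ltr_wpDl.
Qed.

Lemma closed_preimage0 (f : {linear V -> W}) (S : set W) : bounded N M f ->
  closed S -> closed (f @^-1` S).
Proof.
move=> bf /(closed_nrmP M) cS; apply/(closed_nrmP N) => x xP.
apply: cS => e e0; have [d d0 dP] := bounded_approx x bf e0.
by have [y Sy yx] := xP d d0; exists (f y) => //; exact: dP.
Qed.

Lemma closed_set0 : closed [set 0 : W].
Proof.
apply/(closed_nrmP M) => x xP; apply/(nrm_eq0 (b := M))/eqP.
rewrite eq_le nrm_ge0 andbT; apply/ler_addgt0Pl => e e0; rewrite addr0.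
by have [y -> /ltW] := xP e e0; rewrite sub0r nrmN.
Qed.

Lemma closed_ker (f : {linear V -> W}) : bounded N M f -> closed [set x | f x = 0].
Proof. by move=> bf; have := closed_preimage0 bf closed_set0. Qed.

End Bounded.

End BanachNorms.

(** * Zabreiko's lemma and the closed graph theorem *)

Section ClosedGraph.
Variable R : realType.
Local Notation C := R[i].
Local Notation "r %:C" := (real_complex R r) : ring_scope.
Local Notation h := (2^-1 : R).

Lemma half_pow_gt0 k : 0 < h ^+ k.
Proof. by rewrite exprn_gt0// invr_gt0. Qed.

Lemma half_pow_lt (e : R) : 0 < e -> exists m, forall k, (m <= k)%N -> h ^+ k < e.
Proof.
move=> e0; exists (Num.bound e^-1) => k mk.
have ek := upper_nthrootP mk.
rewrite exprVn -(invrK e) ltf_pV2// posrE ?invr_gt0// exprn_gt0//.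
Qed.

Section Zabreiko.
Variables (V : preTopologicalLmodType C) (N : bnorm V) (p : V -> R).
Hypothesis pZ : forall t x, 0 < t -> p (t%:C *: x) = t * p x.
Hypothesis pB : forall x y, p (x - y) <= p x + p y.
Hypothesis p_sum : forall x (a : nat -> V) c,
  (forall k, p (a k) <= c * h ^+ k) ->
  (forall e, 0 < e -> exists m, forall k, (m <= k)%N -> N (\sum_(i < k) a i - x) < e) ->
  p x <= 2 * c.

Let approx c e x := exists2 a, p a <= c & N (x - a) < e.

(* Baire's argument: otherwise nested balls avoiding the closures of the sets
   [p <= n] shrink to a point at which [p] is infinite. *)
Let sublevel_somewhere_dense : exists n x0 r,
  0 < r /\ forall x, N (x - x0) < r -> forall e, 0 < e -> approx n%:R e x.
Proof.
apply: contrapT => H.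
have step (t : nat * (V * R)) : exists s : V * R, 0 < t.2.2 ->
    [/\ 0 < s.2, s.2 <= t.2.2 / 2, N (s.1 - t.2.1) < t.2.2 / 2 &
        forall a, N (s.1 - a) <= s.2 -> t.1%:R < p a].
  (* The pair [(0, 0)] is a dummy value for nonpositive radii; it makes [choice] applicable to all
     [t]. *)
  case: t => n [x r] /=; have [r0|r0] := pselect (0 < r); last by exists (0, 0).
  apply: contrapT => K; apply: H; exists n, x, (r / 2); split; first by lra.
  move=> y yx e e0; apply: contrapT => nap; apply: K.
  (* The bound [e / 2] keeps the closed ball free of points with [p a <= n]; the bound [r / 2] makes
     the radii decay geometrically. *)
  exists (y, Num.min (e / 2) (r / 2)) => _ /=; split=> //.
  - by rewrite lt_min; apply/andP; split; lra.
  - by rewrite ge_min lexx orbT.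
  - move=> a ya; rewrite ltNge; apply/negP => pa; apply: nap.
    exists a => //; apply: (le_lt_trans ya); rewrite gt_min; apply/orP; left; lra.
have [g gP] := choice step.
pose s := fix s n := if n is m.+1 then g (m, s m) else (0, 1).
have s0 n : 0 < (s n).2.
  by elim: n => [|n IH] /=; [exact: ltr01|have [] := gP (n, s n) IH].
have sP n := gP (n, s n) (s0 n).
have s_half n : (s n).2 <= h ^+ n.
  elim: n => [|n IH]; first by rewrite expr0.
  by have [_ + _ _] := sP n; rewrite /= exprS => /le_trans; apply; lra.
have [|l lP] := @nrm_complete _ _ N (fun n => (s n).1) 1.
  move=> n; have [_ _ + _] := sP n; rewrite /= => /ltW/le_trans; apply.
  by have := s_half n; have := half_pow_gt0 n; lra.
(* Each step moves the centre by less than half the radius and costs at least half the radius, so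
   displacements telescope against radii. *)
have dist n k : N ((s (n + k)%N).1 - (s n).1) <= (s n).2 - (s (n + k)%N).2.
  elim: k => [|k IH]; first by rewrite addn0 !subrr nrm0.
  rewrite addnS; apply: (le_trans (nrm_tri N (s (n + k)%N).1 _ _)).
  by have [_ + + _] := sP (n + k)%N; rewrite /=; lra.
have lim n : N ((s n).1 - l) <= (s n).2.
  apply/ler_addgt0Pl => e e0; have [m mP] := lP e e0.
  rewrite (le_trans (nrm_tri N (s (n + m)%N).1 _ _))// addrC lerD//.
    by apply/ltW/mP; exact: leq_addl.
  by rewrite nrm_dist (le_trans (dist n m))// gerBl ltW.
have big n : n%:R < p l by have [_ _ _] := sP n; apply; exact: (lim n.+1).
have := archi_boundP (ltW (le_lt_trans (ler0n _ 0) (big 0%N))).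
by have := big (Num.bound (p l)); lra.
Qed.

(** Some sublevel set of [p] is dense in a ball, and differences move this ball to the origin.
    Approximating the successive residues then writes [x] as a series whose [p]-values decay like
    [h ^+ k], and [p_sum] bounds [p x] itself. *)
Lemma zabreiko : exists2 k, 0 < k & forall x, p x <= k * N x.
Proof.
have [n [x0 [r [r0 dense]]]] := sublevel_somewhere_dense.
have p0 : p 0 = 0.
  by have := pZ 0 (ltr0Sn _ 1); rewrite scaler0; lra.
pose c := 2 * n%:R : R.
have dense0 x e : N x < r -> 0 < e -> approx c e x.
  move=> xr e0.
  have [||a pa xa] := dense (x0 + x) _ (e / 2); [by rewrite addrC addKr|lra|].
  have [||b pb xb] := dense x0 _ (e / 2); [by rewrite subrr nrm0|lra|].
  exists (a - b); first by rewrite (le_trans (pB _ _))// /c; lra.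
  have -> : x - (a - b) = (x0 + x - a) - (x0 - b).
    by rewrite !opprB [x0 + x]addrC -!addrA [x0 + _]addrCA [x0 + _]addrC subrK [- a + _]addrC.
  by rewrite (le_lt_trans (nrm_sub N _ _))//; lra.
(* Scaling by [h ^+ k] transfers [dense0] to the ball of radius [r * h ^+ k]; the accuracy is chosen
   so that the residue lands in the next ball. *)
have densek (t : nat * V) : exists a, N t.2 < r * h ^+ t.1 ->
    p a <= c * h ^+ t.1 /\ N (t.2 - a) < r * h ^+ t.1.+1.
  case: t => k x /=; have [xr|xr] := pselect (N x < r * h ^+ k); last by exists 0.
  have hk := half_pow_gt0 k.
  have [||a pa xa] := dense0 ((h ^+ k)^-1%:C *: x) (r * h).
  - by rewrite nrmZR gtr0_norm ?invr_gt0// mulrC ltr_pdivrMr.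
  - by rewrite mulr_gt0// invr_gt0.
  exists ((h ^+ k)%:C *: a) => _; split; first by rewrite pZ// mulrC ler_wpM2r// ltW.
  have -> : x - (h ^+ k)%:C *: a = (h ^+ k)%:C *: ((h ^+ k)^-1%:C *: x - a).
    by rewrite scalerBr scalerA -rmorphM/= mulfV ?gt_eqF// scale1r.
  by rewrite nrmZR gtr0_norm// exprS mulrC mulrA ltr_pM2r.
have [g gP] := choice densek.
apply: (@homogeneous_bounded _ _ N p r (2 * c)) => //; first by rewrite p0.
move=> x xr; pose y := fix y k := if k is j.+1 then y j - g (j, y j) else x.
have yr k : N (y k) < r * h ^+ k.
  by elim: k => [|k IH] /=; [rewrite mulr1|have [] := gP (k, y k) IH].
apply: (p_sum (a := fun k => g (k, y k))) => [k|e e0].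
  by have [] := gP (k, y k) (yr k).
have [|m mP] := @half_pow_lt (e / r); first by rewrite divr_gt0.
exists m => k mk.
have -> : \sum_(i < k) g (nat_of_ord i, y i) - x = - y k.
  elim: {mk} k => [|k IH]; first by rewrite big_ord0 sub0r.
  by rewrite big_ord_recr/= addrAC IH opprB addrC.
by rewrite nrmN (lt_trans (yr k))// mulrC -ltr_pdivlMr// mP.
Qed.

End Zabreiko.

(** Zabreiko's lemma applies to the norm of [f x]: completeness of [W] makes the images of the
    partial sums converge, and closedness of the graph identifies their limit with [f x]. *)
Theorem closed_graph (V W : preTopologicalLmodType C) (N : bnorm V) (M : bnorm W)
    (f : {linear V -> W}) :
  (forall x y, (forall e, 0 < e -> exists2 z, N (z - x) < e & M (f z - y) < e) ->
    f x = y) ->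
  bounded N M f.
Proof.
move=> fcl; have [||x a c ac ax|k k0 kP] := @zabreiko V N (fun x => M (f x)).
- by move=> t x t0; rewrite linearZ/= nrmZR gtr0_norm.
- by move=> x y; rewrite linearB; exact: nrm_sub.
- have [|l lP] := @nrm_complete _ _ M (fun k => f (\sum_(i < k) a i)) c.
    by move=> k; rewrite -linearB big_ord_recr/= addrAC subrr add0r.
  have fxl : f x = l.
    apply: fcl => e e0; have [m1 m1P] := lP e e0; have [m2 m2P] := ax e e0.
    exists (\sum_(i < maxn m1 m2) a i); first by rewrite m2P// leq_maxr.
    by rewrite m1P// leq_maxl.
  have c0 : 0 <= c by have := ac 0%N; rewrite mulr1; apply: le_trans; exact: nrm_ge0.
  have fsum k : M (f (\sum_(i < k) a i)) <= 2 * c * (1 - h ^+ k).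
    elim: k => [|k IH]; first by rewrite big_ord0 linear0 nrm0 expr0 subrr mulr0.
    rewrite big_ord_recr/= linearD (le_trans (nrmD M _ _))//.
    by have := ac k; rewrite exprS; lra.
  rewrite fxl; apply/ler_addgt0Pl => e e0; have [m mP] := lP e e0.
  rewrite -[l](subKr (f (\sum_(i < m) a i))) (le_trans (nrm_sub M _ _))// addrC.
  rewrite lerD//; first by rewrite ltW// mP.
  rewrite (le_trans (fsum m))// ler_piMr//; first exact: mulr_ge0.
by exists k => //; exact: ltW.
Qed.

End ClosedGraph.

(** * Complex Hahn-Banach theorem *)

Section HahnBanach.
Variable R : realType.
Local Notation C := R[i].
Local Notation "r %:C" := (real_complex R r) : ring_scope.
Variables (V : preTopologicalLmodType C) (N : bnorm V).

Let affine (G : set (V * R)) := forall t p q, G p -> G q ->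
  G (t%:C *: p.1 + q.1, t * p.2 + q.2).
Let dominated (G : set (V * R)) := forall p, G p -> p.2 <= N p.1.

(* One step of the Hahn-Banach extension: the graph [G] is extended to a vector [x]
   by giving it a value [a] between the two families of bounds. *)
Let extend (G : set (V * R)) x : affine G -> dominated G -> G (0, 0) ->
  exists a, dominated [set p | exists q t, G q /\ p = (q.1 + t%:C *: x, q.2 + t * a)].
Proof.
move=> Ga Gd G0.
pose E := [set q.2 - N (q.1 - x) | q in G].
have Eub p : G p -> ubound E (N (p.1 + x) - p.2).
  move=> Gp _ [q Gq <-]; have := Gd _ (Ga 1 p q Gp Gq).
  rewrite /= rmorph1 scale1r mul1r => le1.
  have : N (p.1 + q.1) <= N (p.1 + x) + N (q.1 - x).
    by apply: le_trans (nrmD N _ _); rewrite addrACA subrr addr0.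
  lra.
have E0 : E !=set0 by exists (0 - N (0 - x)), (0, 0).
exists (sup E) => _ [q [t [Gq ->]]] /=.
have lower p : G p -> p.2 - N (p.1 - x) <= sup E.
  by move=> Gp; apply: ub_le_sup; [exists (N (0 + x) - 0); exact: (Eub (0, 0))|exists p].
have upper p : G p -> sup E <= N (p.1 + x) - p.2 by move=> Gp; exact: ge_sup (Eub p Gp).
have scaled s p : G p -> G (s%:C *: p.1, s * p.2).
  by move=> Gp; have := Ga s p _ Gp G0; rewrite /= !addr0.
have [t0|t0|->] := ltgtP t 0; last by rewrite scale0r mul0r !addr0; exact: Gd.
- have := lower _ (scaled (- t)^-1 q Gq); rewrite /= => le1.
  have nt : 0 < - t by lra.
  have -> : N (q.1 + t%:C *: x) = - t * N ((- t)^-1%:C *: q.1 - x).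
    rewrite -(gtr0_norm nt) -nrmZR scalerBr scalerA -rmorphM gtr0_norm//.
    by rewrite mulfV ?gt_eqF// scale1r rmorphN scaleNr opprK.
  move: le1; rewrite -(ler_pM2l nt) mulrBr mulrA mulfV ?gt_eqF// mul1r; lra.
- have := upper _ (scaled t^-1 q Gq); rewrite /= => le1.
  have -> : N (q.1 + t%:C *: x) = t * N (t^-1%:C *: q.1 + x).
    rewrite -[in RHS](gtr0_norm t0) -nrmZR scalerDr scalerA -rmorphM gtr0_norm//.
    by rewrite mulfV ?gt_eqF// scale1r.
  move: le1; rewrite -(ler_pM2l t0) mulrBr mulrA mulfV ?gt_eqF// mul1r; lra.
Qed.

(** A maximal dominated graph is total by [extend], and single-valued because two values at one
    point differ by at most [N 0 = 0]. *)
Let real_functional (v : V) : exists u : V -> R,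
  [/\ forall t x y, u (t%:C *: x + y) = t * u x + u y, forall x, u x <= N x & u v = N v].
Proof.
(* Membership of [(v, N v)] is conditional so that the empty set, the union of the empty chain,
   satisfies [P]. *)
pose P G := [/\ affine G, dominated G & G !=set0 -> G (v, N v)].
have [F FP Ftot|G [[Ga Gd Gv] Gmax]] := @Zorn_bigcup _ P.
  split.
  - move=> t p q [A FA Ap] [B FB Bq].
    have [AB|BA] := Ftot A B FA FB.
    + by exists B => //; have [Ba _ _] := FP B FB; apply: Ba => //; exact: AB.
    + by exists A => //; have [Aa _ _] := FP A FA; apply: Aa => //; exact: BA.
  - by move=> p [A FA Ap]; have [_ Ad _] := FP A FA; exact: Ad.
  - move=> [p [A FA Ap]]; exists A => //; have [_ _] := FP A FA; apply.
    by exists p.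
have {}Gv : G (v, N v).
  apply: Gv; apply: contrapT => /set0P/negP/negPn/eqP G0.
  apply: (Gmax [set (t%:C *: v, t * N v) | t in [set: R]]).
    rewrite G0 properEneq; split; last exact: sub0set.
    by rewrite eq_sym; apply/set0P; exists (0%:C *: v, 0 * N v), 0.
  split.
  - move=> t _ _ [r _ <-] [s _ <-]; exists (t * r + s) => //=.
    by rewrite scalerA -scalerDl -rmorphM -rmorphD mulrA -mulrDl.
  - move=> _ [t _ <-] /=; rewrite nrmZR ler_wpM2r ?nrm_ge0//; exact: ler_norm.
  - by move=> _; exists 1 => //; rewrite rmorph1 scale1r mul1r.
have G00 : G (0, 0).
  by have := Ga (-1) _ _ Gv Gv; rewrite /= rmorphN1 scaleN1r mulN1r !addNr.
have tot x : exists r, G (x, r).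
  apply: contrapT => nx; have [a ad] := extend x Ga Gd G00.
  set G' := [set p | _] in ad; have GG' : G `<=` G'.
    by move=> [y r] Gy; exists (y, r), 0; split=> //; rewrite scale0r mul0r !addr0.
  have G'x : G' (x, a) by exists (0, 0), 1; rewrite rmorph1 scale1r mul1r !add0r.
  apply: (Gmax G'); first by split=> // G'G; apply: nx; exists a; exact: G'G.
  split=> //; last by move=> _; exact: GG'.
  move=> t _ _ [p [r [Gp ->]]] [q [s [Gq ->]]] /=.
  exists (t%:C *: p.1 + q.1, t * p.2 + q.2), (t * r + s); split; first exact: Ga.
  rewrite /= scalerDr scalerA -rmorphM addrACA -scalerDl -rmorphD.
  by congr (_, _); ring.
have [u uP] := choice tot.
have uniq x r : G (x, r) -> u x = r.
  have le r1 r2 : G (x, r1) -> G (x, r2) -> r1 <= r2.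
    move=> G1 G2; have := Gd _ (Ga (-1) _ _ G2 G1).
    by rewrite /= rmorphN1 scaleN1r addNr nrm0; lra.
  by move=> Gr; apply/eqP; rewrite eq_le !le.
exists u; split=> [t x y|x|]; last exact: uniq.
- by apply: uniq; exact: (Ga t (x, u x) (y, u y)).
- exact: (Gd (x, u x)).
Qed.

Lemma normc_le_sum (a b : R) : normc (a +i* b)%C <= `|a| + `|b|.
Proof.
rewrite /= -[leRHS]ger0_norm ?addr_ge0// -sqrtr_sqr ler_wsqrtr// sqrrD.
by rewrite !real_normK ?num_real// addrAC lerDl mulrn_wge0// mulr_ge0.
Qed.

(** From the real functional [u], the complex one is [u x - i u (i x)]; its real part at [v] is
    [N v], which is positive. *)
Theorem separating_functional (v : V) : v <> 0 -> exists phi : V -> C,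
  [/\ forall a x y, phi (a *: x + y) = a * phi x + phi y,
      bounded (W := C^o) N (@normc R) phi & phi v != 0].
Proof.
move=> v0; have [u [ul uN uv]] := real_functional v.
have uD x y : u (x + y) = u x + u y.
  by rewrite -[x]scale1r -(rmorph1 (real_complex R)) ul rmorph1 scale1r mul1r.
have u0 : u 0 = 0 by have := uD 0 0; rewrite addr0; lra.
have uZ t x : u (t%:C *: x) = t * u x by rewrite -[_ *: x]addr0 ul u0 addr0.
have uabs x : `|u x| <= N x.
  rewrite ler_norml uN andbT lerNl -mulN1r -uZ (le_trans (uN _))//.
  by rewrite rmorphN1 scaleN1r nrmN.
exists (fun x => (u x -i* u ('i%C *: x))%C); split.
- move=> [s t] x y.
  have e1 : ((s +i* t)%C : C) = s%:C + t%:C * 'i%C.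
    by apply/eqP; rewrite eq_complex /=; apply/andP; split; apply/eqP; ring.
  have e2 : u ((s +i* t)%C *: x + y) = s * u x + t * u ('i%C *: x) + u y.
    by rewrite uD e1 scalerDl -scalerA uD !uZ.
  have e3 : u ('i%C *: ((s +i* t)%C *: x + y)) = s * u ('i%C *: x) - t * u x + u ('i%C *: y).
    rewrite scalerDr uD scalerA e1 mulrDr mulrCA -expr2 sqr_i scalerDl uD.
    by rewrite mulrN1 -rmorphN [_ * s%:C]mulrC -scalerA !uZ mulNr.
  by rewrite e2 e3; apply/eqP; rewrite eq_complex /=; apply/andP; split; apply/eqP; ring.
- exists 2 => // x; rewrite (le_trans (normc_le_sum _ _))// normrN mulrDl mul1r lerD//.
  rewrite (le_trans (uabs _))// nrmZ; have -> : normc ('i%C : C) = 1; last by rewrite mul1r.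
  by rewrite /= expr0n/= add0r expr1n sqrtr1.
- rewrite eq_complex /= uv negb_and gt_eqF//; exact: nrm_gt0.
Qed.

End HahnBanach.

(** * Finite dimension and codimension *)

Section FiniteDimension.
Variable K : numFieldType.

(** Linear independence in the quotient by [S], without forming the quotient. It covers both
    [lin_indep], where [S] is zero, and the families in [infinite_codim]. *)
Definition lin_indep_mod (V : lmodType K) (S : set V) m (v : 'I_m -> V) :=
  forall c : 'I_m -> K, S (\sum_(i < m) c i *: v i) -> forall i, c i = 0.

Definition findim (V : lmodType K) (U : set V) := exists m (w : 'I_m -> V),
  forall x, U x -> exists c : 'I_m -> K, x = \sum_(i < m) c i *: w i.

Lemma lin_indep_mod_extend (V : lmodType K) (S : set V) m (v : 'I_m -> V) x :
  lin_subspace S -> lin_indep_mod S v ->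
  (forall c, ~ S (x - \sum_(i < m) c i *: v i)) ->
  lin_indep_mod S (fun i : 'I_m.+1 => oapp v x (unlift ord0 i)).
Proof.
move=> [S0 Sl] vi nx c; rewrite big_ord_recl unlift_none/=.
under eq_bigr do rewrite liftK /=.
move=> Sc; have c0 : c ord0 = 0.
  apply/eqP/negP => /negP c0; apply: (nx (fun i => - ((c ord0)^-1 * c (lift ord0 i)))).
  under eq_bigr do rewrite scaleNr -scalerA.
  rewrite sumrN opprK -scaler_sumr -[x in x + _](scalerK c0) -scalerDr.
  by rewrite -[_ *: _]addr0; exact: Sl.
move: Sc; rewrite c0 scale0r add0r => /vi cl i.
by have [j ->|->//] := unliftP ord0 i; exact: cl.
Qed.

(** An independent family that does not span [U] modulo [S] can be enlarged; if this never stopped,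
    there would be such families of every length. *)
Lemma span_mod (V : lmodType K) (U S : set V) : lin_subspace S ->
  ~ (forall m, exists v : 'I_m -> V, (forall i, U (v i)) /\ lin_indep_mod S v) ->
  exists m (w : 'I_m -> V), forall x, U x ->
    exists c : 'I_m -> K, S (x - \sum_(i < m) c i *: w i).
Proof.
move=> lS nU; apply: contrapT => nspan; apply: nU => m.
elim: m => [|m [v [Uv vi]]]; first by exists (fun=> 0); split=> [[]//|c _ []].
have [x Ux nx] : exists2 x, U x & forall c, ~ S (x - \sum_(i < m) c i *: v i).
  apply: contrapT => nx; apply: nspan; exists m, v => x Ux.
  apply: contrapT => nc; apply: nx; exists x => // c Sc; apply: nc; exists c.
  exact: Sc.
exists (fun i : 'I_m.+1 => oapp v x (unlift ord0 i)); split.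
  by move=> i; case: (unlift ord0 i).
exact: lin_indep_mod_extend.
Qed.

Lemma lin_subspace0 (V : lmodType K) : lin_subspace [set 0 : V].
Proof. by split=> // a x y -> ->; rewrite scaler0 addr0. Qed.

Lemma not_infinite_dim_findim (V : lmodType K) (U : set V) :
  ~ infinite_dim U -> findim U.
Proof.
move=> nU; have [|m [w wP]] := span_mod (U := U) (@lin_subspace0 V); first exact: nU.
exists m, w => x Ux; have [c /eqP] := wP x Ux; rewrite subr_eq0 => /eqP ->.
by exists c.
Qed.

Lemma not_infinite_codim_span (V : lmodType K) (S : set V) : lin_subspace S ->
  ~ infinite_codim S -> exists m (w : 'I_m -> V),
    forall x, exists c : 'I_m -> K, S (x - \sum_(i < m) c i *: w i).
Proof.
move=> lS nS; have [H|m [w wP]] := span_mod (U := setT) lS.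
  by apply: nS => m; have [v [_ vi]] := H m; exists v.
by exists m, w => x; exact: wP.
Qed.

Lemma lin_indep_row_free (V : lmodType K) m q (v : 'I_q -> V) (B : 'M[K]_(m, q)) :
  row_free B -> lin_indep v -> lin_indep (fun l => \sum_j B l j *: v j).
Proof.
move=> Bf vi c.
have -> : \sum_l c l *: (\sum_j B l j *: v j) = \sum_j (\sum_l c l * B l j) *: v j.
  under [RHS]eq_bigr do rewrite scaler_suml; rewrite [RHS]exchange_big.
  apply: eq_bigr => l _; rewrite scaler_sumr; apply: eq_bigr => j _.
  by rewrite scalerA.
move=> /vi cB i; have : (\row_j c j) *m B = 0.
  by apply/rowP => j; rewrite !mxE -[RHS](cB j); apply: eq_bigr => l _; rewrite mxE.
by move=> /eqP; rewrite mulmx_free_eq0// => /eqP/rowP/(_ i); rewrite !mxE.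
Qed.

(** Rank-nullity. It serves to eliminate [p] unwanted coordinates from [m + p] vectors while keeping
    [m] independent combinations. *)
Lemma exists_row_free_ker m p (c : 'M[K]_(m + p, p)) :
  exists B : 'M[K]_(m, m + p), row_free B /\ B *m c = 0.
Proof.
pose r := \rank (kermx c); have mr : (m <= r)%N.
  by rewrite /r mxrank_ker -(leq_add2r (\rank c)) subnK ?rank_leq_row// leq_add2l rank_leq_col.
exists ((pid_mx m : 'M[K]_(m, r)) *m row_base (kermx c)); split.
  by rewrite /row_free mxrankMfree ?row_base_free// rank_pid_mx.
rewrite -mulmxA; have /sub_kermxP -> : (row_base (kermx c) <= kermx c)%MS.
  by rewrite eq_row_base.
by rewrite mulmx0.
Qed.

Lemma findim_finite_dim (V : lmodType K) (U : set V) : findim U -> ~ infinite_dim U.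
Proof.
move=> [p [w wP]] iU; have [v [Uv vi]] := iU (1 + p)%N.
have [c cP] := choice (fun j => wP (v j) (Uv j)).
have [B [Bf Bc]] := exists_row_free_ker (\matrix_(j, i) c j i : 'M[K]_(1 + p, p)).
have /(_ (fun=> 1)) := lin_indep_row_free Bf vi; rewrite big_ord1 scale1r.
suff -> : \sum_j B ord0 j *: v j = 0 by move=> /(_ erefl ord0)/eqP; rewrite oner_eq0.
under eq_bigr do rewrite cP scaler_sumr; rewrite exchange_big big1// => i _.
under eq_bigr do rewrite scalerA; rewrite -scaler_suml.
suff -> : \sum_j B ord0 j * c j i = 0 by rewrite scale0r.
have /matrixP/(_ ord0 i) := Bc; rewrite !mxE => e; rewrite -[RHS]e.
by apply: eq_bigr => j _; rewrite mxE.
Qed.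

Lemma findim_sub (V : lmodType K) (U U' : set V) : U' `<=` U -> findim U -> findim U'.
Proof. by move=> sU [m [w wP]]; exists m, w => x /sU; exact: wP. Qed.

Lemma findim_image (V W : lmodType K) (f : {linear V -> W}) (U : set V) :
  findim U -> findim (f @` U).
Proof.
move=> [m [w wP]]; exists m, (f \o w) => _ [x Ux <-]; have [c ->] := wP x Ux.
by exists c; rewrite linear_sum; apply: eq_bigr => i _; rewrite linearZ.
Qed.

Lemma findim_rangeD (V W : lmodType K) (f g : V -> W) :
  findim (range f) -> findim (range g) -> findim (range (f \+ g)).
Proof.
move=> [m [w wP]] [n [z zP]].
exists (m + n)%N, (fun i => match fintype.split i with inl j => w j | inr j => z j end).
move=> _ [x _ <-]; have [c cP] := wP (f x) (imageT f x).
have [d dP] := zP (g x) (imageT g x).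
exists (fun i => match fintype.split i with inl j => c j | inr j => d j end).
rewrite big_split_ord /= cP dP; congr (_ + _); apply: eq_bigr => i _.
  by rewrite (unsplitK (inl i)).
by rewrite (unsplitK (inr i)).
Qed.

Lemma findim_range_sum (V W : lmodType K) (I : finType) (f : I -> V -> W) :
  (forall i, findim (range (f i))) -> findim (range (fun x => \sum_i f i x)).
Proof.
move=> ff; elim: (index_enum I) => [|i s IH].
  exists 0%N, (fun=> 0) => _ [x _ <-]; exists (fun=> 0).
  by rewrite big_nil big_ord0.
rewrite (_ : (fun x => _) = f i \+ (fun x => \sum_(j <- s) f j x)).
  exact: findim_rangeD.
by apply/funext => x; rewrite big_cons.
Qed.

End FiniteDimension.

(** * Left Fredholm operators and left inverses modulo finite rank *)

Section Fredholm.
Variable R : realType.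
Local Notation C := R[i].

Lemma linear_fun_ex (V W : lmodType C) (f : V -> W) :
  linear f -> exists g : {linear V -> W}, g = f :> (V -> W).
Proof.
move=> lf; pose b := GRing.isLinear.Build _ _ _ _ f lf.
by exists (HB.pack_for {linear V -> W} f b).
Qed.

(* While [f h] does not fix [f @` U], a rank one correction enlarges the linearly
   independent family of vectors it fixes. *)
Lemma finite_rank_right_inverse (V W : preTopologicalLmodType C)
    (N : bnorm V) (M : bnorm W) (f : {linear V -> W}) (U : set V) :
  bounded N M f -> lin_subspace U -> ~ infinite_dim (f @` U) ->
  exists h : {linear W -> V},
    [/\ bounded M N h, forall y, U (h y) & forall y, (f @` U) y -> f (h y) = y].
Proof.
move=> bf [U0 Ul] fdU; apply: contrapT => noh; apply: fdU => m.
(* The induction also carries [h f h = h]: it makes [f h] idempotent, so that a correction can leave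
   the vectors already fixed untouched. *)
suff [h [v [bh Uh hfh Uv vi]]] : exists (h : {linear W -> V}) (v : 'I_m -> W),
    [/\ bounded M N h, forall y, U (h y), forall y, h (f (h y)) = h y,
        forall i, (f @` U) (v i) /\ f (h (v i)) = v i & lin_indep_mod [set 0] v].
  by exists v; split=> // i; have [] := Uv i.
elim: m => [|m [h [v [bh Uh hfh vP vi]]]].
  exists (GRing.null_fun V : {linear W -> V}), (fun=> 0); split=> [||//|[]//|c _ []//].
  - exact: bounded0.
  - by move=> y; exact: U0.
have [_ [u Uu <-] nfix] : exists2 y, (f @` U) y & f (h y) <> y.
  apply: contrapT => K; apply: noh; exists h; split=> // y Uy.
  by apply: contrapT => ny; apply: K; exists y.
have UB x y : U x -> U y -> U (x - y).
  by move=> Ux Uy; rewrite addrC -scaleN1r; exact: Ul.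
(* Subtracting [h (f u)] from [u] leaves a vector killed by [h f]; its image is nonzero because
   [f h] does not fix [f u]. *)
have [z [Uz hz fz0]] : exists z, [/\ U z, h (f z) = 0 & f z <> 0].
  exists (u - h (f u)); split; first exact: UB.
    by rewrite !linearB hfh subrr.
  by rewrite linearB => /subr0_eq /esym.
have [psi [psil bpsi psiz]] := separating_functional M fz0.
have psiB x y : psi (x - y) = psi x - psi y.
  by rewrite addrC -scaleN1r psil mulN1r addrC.
(* Normalised to be 1 at [f z]; precomposing with [1 - f h] makes [phi] vanish on the range of
   [f h]. *)
pose phi y := (psi (f z))^-1 * psi (y - f (h y)).
have phil a x y : phi (a *: x + y) = a * phi x + phi y.
  rewrite /phi [h _]linearP [f (_ + _)]linearP opprD addrACA -scalerBr psil mulrDr.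
  by rewrite mulrCA.
have bphi : bounded (W := C^o) M (@normc R) phi.
  have [c c0 cP] := bpsi.
  have bP : bounded M M (fun y => y - f (h y)).
    apply: bounded_sub; first exact: bounded_id.
    exact: bounded_comp bf bh.
  apply: (bounded_comp (W := C^o) (f := fun y => (psi (f z))^-1 * psi y) _ bP).
  exists (normc (psi (f z))^-1 * c); first by rewrite mulr_ge0// normc_ge0.
  by move=> y; rewrite normcM -mulrA ler_wpM2l// normc_ge0.
have phiz : phi (f z) = 1 by rewrite /phi hz linear0 subr0 mulVf.
have phifh y : phi (f (h y)) = 0.
  by rewrite /phi hfh subrr -(subrr (f 0)) psiB subrr mulr0.
have [|h' h'E] := @linear_fun_ex W V (fun y => h y + phi y *: z).
  move=> a x y /=; rewrite linearP phil scalerDl scalerDr -scalerA -!addrA.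
  by congr (_ + _); rewrite addrCA.
have phiv i : phi (v i) = 0 by have [_ <-] := vP i; exact: phifh.
exists h', (fun i : 'I_m.+1 => oapp v (f z) (unlift ord0 i)); rewrite h'E; split.
- by apply: bounded_add bh _; exact: bounded_rank1.
- by move=> y; rewrite addrC; apply: Ul => //; exact: Uh.
- move=> y; rewrite !linearD !linearZ /= hz hfh scaler0 addr0.
  by congr (_ + _ *: _); rewrite addrC phil phiz phifh mulr1 addr0.
- move=> i; case: (unlift ord0 i) => [j|] /=.
    by have [? e] := vP j; rewrite phiv scale0r addr0 e.
  by split; [exists z|rewrite hz phiz scale1r add0r].
- apply: lin_indep_mod_extend => //; first exact: lin_subspace0.
  move=> c /subr0_eq zE; apply: fz0.
  have : f (h (f z)) = f z.
    rewrite zE !linear_sum; apply: eq_bigr => i _.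
    by rewrite !linearZ /=; have [_ ->] := vP i.
  by rewrite hz linear0.
Qed.

Lemma lin_subspace_range (V W : lmodType C) (f : {linear V -> W}) : lin_subspace (range f).
Proof.
split; first by exists 0; rewrite ?linear0.
by move=> a _ _ [x _ <-] [y _ <-]; exists (a *: x + y); rewrite ?linearP.
Qed.

Lemma lin_subspace_ker (V W : lmodType C) (f : {linear V -> W}) :
  lin_subspace [set x | f x = 0].
Proof.
split=> [|a x y /= fx fy]; first by rewrite /= linear0.
by rewrite linearP fx fy scaler0 addr0.
Qed.

(** The kernel of [f] lies in the range of [F]. With [h] a right inverse of [f] on the image of that
    range, [Q = f (S + h (1 - f S))] satisfies [Q f = f], since [1 - f S] sends [f x] to [f (F x)].
    So [Q] is a bounded projection onto the range of [f], whose complement is the kernel of [Q]. *)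
Lemma left_fredholm_of_left_inverse (V W : preTopologicalLmodType C)
    (N : bnorm V) (M : bnorm W) (f : {linear V -> W}) (S : {linear W -> V})
    (F : {linear V -> V}) :
  bounded N M f -> bounded M N S -> findim (range F) ->
  (forall x, S (f x) = x - F x) -> left_fredholm f.
Proof.
move=> bf bS fF SfE; split.
  apply: findim_finite_dim; apply: findim_sub fF => x /= fx.
  by exists x => //; have := SfE x; rewrite fx linear0 => /esym/subr0_eq.
have [|h [bh _ hP]] := finite_rank_right_inverse bf (lin_subspace_range F).
  exact/findim_finite_dim/findim_image.
have [Q QE] : exists Q : {linear W -> W}, Q = f \o (S \+ (h \o (idfun \- (f \o S)))) :> (W -> W).
  by exists (f \o (S \+ (h \o (idfun \- (f \o S))))).
have Qf x : Q (f x) = f x.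
  have fFx : (f @` range F) (f (F x)) by exists (F x) => //; exists x.
  by rewrite QE /= SfE [f (x - _)]linearB subKr linearD hP// linearB subrK.
have bQ : bounded M M Q.
  rewrite QE; apply: (bounded_comp bf); apply: (bounded_add bS).
  apply: (bounded_comp bh); apply: bounded_sub; first exact: bounded_id.
  exact: bounded_comp bf bS.
have rQ y : range f (Q y) by rewrite QE; exists (S y + h (y - f (S y))).
have rE : range f = [set y | (idfun \- Q) y = 0].
  apply/seteqP; split=> [_ [x _ <-]|y /= /subr0_eq ->]; last exact: rQ.
  by rewrite /= Qf subrr.
split; [exact: lin_subspace_range|split].
  by rewrite rE; apply: (closed_ker (N := M) (M := M)); apply: bounded_sub; [exact: bounded_id|].
exists [set y | Q y = 0]; split; [exact: lin_subspace_ker|split; [exact: closed_ker bQ|split]].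
  apply/seteqP; split=> [y [[x _ <-] /=]|y ->]; first by rewrite Qf.
  by split=> /=; [exists 0 => //; rewrite linear0|rewrite linear0].
move=> y; exists (Q y), (y - Q y); split=> //; split; last by rewrite addrC subrK.
by have [x _ fx] := rQ y; rewrite /= linearB -fx Qf subrr.
Qed.

(* The left inverse is bounded by the closed graph theorem: [S v] is the unique [c] in
   the kernel of a projection onto [ker T] such that [J v - T c] lies in a closed
   complement of [range T]. *)
Lemma left_fredholm_left_inverse (V Y W : preTopologicalLmodType C)
    (N : bnorm V) (M : bnorm Y) (L : bnorm W)
    (T : {linear Y -> W}) (J : {linear V -> W}) :
  bounded M L T -> bounded N L J -> left_fredholm T ->
  exists (S : {linear V -> Y}) (F : {linear Y -> Y}),
    [/\ bounded N M S, findim (range F) & forall v y, T y = J v -> S v = y - F y].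
Proof.
move=> bT bJ [aT [_ [_ [Z [[Z0 Zl] [Zc [rTZ dec]]]]]]].
(* Taking the identity for [f] and [ker T] for [U] gives a bounded projection [P] onto [ker T]. *)
have [|P [bP kP fixP]] := finite_rank_right_inverse (f := idfun) (bounded_id M)
  (lin_subspace_ker T); first by rewrite image_id.
rewrite image_id in fixP.
have ZB x y : Z x -> Z y -> Z (x - y).
  by move=> Zx Zy; rewrite addrC -scaleN1r; exact: Zl.
have PP y : P (y - P y) = 0 by rewrite linearB [P (P y)]fixP ?subrr//; exact: kP.
have TP y : T (y - P y) = T y by rewrite linearB (kP y) subr0.
pose good v c := P c = 0 /\ Z (J v - T c).
have goodP v : exists c, good v c.
  have [_ [z [[y _ <-] [Zz Jv]]]] := dec (J v); exists (y - P y); split; first exact: PP.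
  by rewrite TP Jv addrC addKr.
have uniq v c c' : good v c -> good v c' -> c = c'.
  move=> [Pc Zc1] [Pc' Zc2]; apply: subr0_eq.
  have Tcc : T (c - c') = 0.
    suff : (range T `&` Z) (T (c - c')) by rewrite rTZ.
    split; first by exists (c - c').
    suff -> : T (c - c') = (J v - T c') - (J v - T c) by exact: ZB.
    by rewrite linearB opprB [RHS]addrC subrKA.
  by rewrite -[LHS]fixP// linearB Pc Pc' subrr.
have [s sP] := choice goodP.
have [|S SE] := @linear_fun_ex V Y s.
  move=> a x y; apply: (uniq (a *: x + y)) => //.
  have [Px Zx] := sP x; have [Py Zy] := sP y; split.
    by rewrite linearP Px Py scaler0 addr0.
  by rewrite [J _]linearP [T _]linearP opprD addrACA -scalerBr; exact: Zl.
exists S, P; split.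
(* Both conditions in [good] are closed, so they pass to the limit, where uniqueness applies. *)
- apply: closed_graph => x y xy; rewrite SE; apply: (uniq x) => //; split.
    have /(closed_nrmP M) := closed_ker bP; apply => e e0.
    have [z _ zy] := xy e e0; exists (S z) => //=.
    by rewrite SE; have [] := sP z.
  have /(closed_nrmP L) := Zc; apply => e e0.
  have [d d0 dP] := bounded_approx x bJ (divr_gt0 e0 (ltr0Sn _ 1)).
  have [d' d'0 d'P] := bounded_approx y bT (divr_gt0 e0 (ltr0Sn _ 1)).
  have [|z zx zy] := xy (Num.min d d'); first by rewrite lt_min d0.
  exists (J z - T (S z)); first by rewrite SE; have [] := sP z.
  have -> : J z - T (S z) - (J x - T y) = (J z - J x) - (T (S z) - T y).
    by rewrite !opprB addrACA [RHS]addrACA [- T _ - _]addrC.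
  rewrite (le_lt_trans (nrm_sub L _ _))// [ltRHS]splitr ltrD//.
    by apply: dP; rewrite (lt_le_trans zx)// ge_min lexx.
  by apply: d'P; rewrite (lt_le_trans zy)// ge_min lexx orbT.
- apply: findim_sub (not_infinite_dim_findim aT) => _ [y _ <-]; exact: kP.
- move=> v y Ty; rewrite SE; apply: (uniq v) => //; split; first exact: PP.
  by rewrite TP Ty subrr.
Qed.

End Fredholm.

(** * Norms on Banach spaces and their finite direct sums *)

Section NormedModule.
Variables (R : realType) (X : completeNormedModType R[i]).
Local Notation "r %:C" := (real_complex R r) : ring_scope.

(** The norm of [X] takes values in [R[i]]; being nonnegative it is real, so its real part carries
    all of it. *)
Let N (x : X) : R := complex.Re `|x|.

Let NE x : (N x)%:C = `|x|.
Proof. by apply: RRe_real; rewrite realE normr_ge0. Qed.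

Let nbhs_N (x : X) (A : set X) :
  nbhs x A <-> exists2 e, 0 < e & forall y, N (y - x) < e -> A y.
Proof.
split=> [/nbhs_normP[e /= e0 eA]|[e e0 eA]].
  have eE : (complex.Re e)%:C = e by apply: RRe_real; rewrite realE ltW.
  exists (complex.Re e); first by rewrite -ltcR eE.
  by move=> y ye; apply: eA; rewrite /= distrC -NE -eE ltcR.
apply/nbhs_normP; exists e%:C; first by rewrite /= ltcR.
by move=> y /=; rewrite distrC -NE ltcR; exact: eA.
Qed.

Let N_complete (u : nat -> X) (c : R) :
  (forall k, N (u k.+1 - u k) <= c * 2^-1 ^+ k) ->
  exists l, forall e, 0 < e -> exists m, forall k, (m <= k)%N -> N (u k - l) < e.
Proof.
move=> uc; have c0 : 0 <= c.
  by have := uc 0%N; rewrite mulr1; apply: le_trans; rewrite -lecR NE rmorph0.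
have ND x y : N (x + y) <= N x + N y by rewrite -lecR rmorphD/= !NE ler_normD.
have tail m k : N (u (m + k)%N - u m) <= 2 * c * (2^-1 ^+ m - 2^-1 ^+ (m + k)).
  elim: k => [|k IH]; first by rewrite addn0 !subrr mulr0 /N normr0.
  rewrite addnS -(subrKA (u (m + k)%N)) (le_trans (ND _ _))//.
  by have := uc (m + k)%N; rewrite exprS; lra.
have cvgu : cvg (u @ \oo).
  apply: cauchy_cvg; apply: cauchy_exP => e e0.
  have eE : (complex.Re e)%:C = e by apply: RRe_real; rewrite realE ltW.
  have e0' : 0 < complex.Re e by rewrite -ltcR eE.
  (* Adding 1 avoids a division by zero when [c = 0]. *)
  have c1 : 0 < 2 * c + 1 by lra.
  have [m mP] := half_pow_lt (divr_gt0 e0' c1).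
  exists (u m); exists m => // k /= mk; rewrite -ball_normE /= distrC -NE -eE ltcR.
  rewrite -(subnKC mk) (le_lt_trans (tail _ _))//.
  have := mP m (leqnn m); rewrite ltr_pdivlMr// => hm.
  have := half_pow_gt0 R m; have := half_pow_gt0 R (m + (k - m)) => h1 h2.
  by nra.
exists (lim (u @ \oo)) => e e0.
have /cvgrPdist_lt/(_ e%:C)[|m _ mP] := cvgu; first by rewrite ltcR.
by exists m => k /mP /=; rewrite distrC -NE ltcR.
Qed.

Definition normed_bnorm : bnorm X.
Proof.
refine (@BNorm R X N _ _ _ nbhs_N N_complete).
- by move=> x y; rewrite -lecR rmorphD/= !NE ler_normD.
- move=> a x; apply: complexI; rewrite rmorphM/= !NE normrZ; congr (_ * _).
- by move=> x x0; apply/eqP; rewrite -normr_eq0 -NE x0.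
Defined.

End NormedModule.

Section DirectSumNorm.
Variables (R : realType) (n : nat) (X : 'I_n -> preTopologicalLmodType R[i]).
Variable N : forall i, bnorm (X i).
Local Notation Y := (dsum X).

Let M (x : Y) : R := \sum_i N i (x i).

Let M_comp (x : Y) i : N i (x i) <= M x.
Proof. by rewrite /M (bigD1 i)//= lerDl sumr_ge0// => j _; exact: nrm_ge0. Qed.

(** The denominator [n.+1] is nonzero even for [n = 0] and makes the total strictly smaller than
    [e]. *)
Let M_lt (x : Y) e : 0 < e -> (forall i, N i (x i) < e / n.+1%:R) -> M x < e.
Proof.
move=> e0 xe; rewrite (@le_lt_trans _ _ (\sum_(i < n) e / n.+1%:R))//.
  by apply: ler_sum => i _; exact: ltW.
rewrite sumr_const card_ord -[_ *+ n]mulr_natr -mulrA gtr_pMr//.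
by rewrite mulrC ltr_pdivrMr// mul1r ltr_nat.
Qed.

Let nbhs_M (x : Y) (A : set Y) :
  nbhs x A <-> exists2 e, 0 < e & forall y, M (y - x) < e -> A y.
Proof.
split.
  pose F := filter_from [set e : R | 0 < e] (fun e => [set y | M (y - x) < e]).
  have FF : Filter F.
    apply: filter_from_filter; first by exists 1 => /=.
    move=> e d e0 d0; exists (Num.min e d); first by rewrite /= lt_min e0.
    by move=> y; rewrite /= lt_min => /andP[].
  (* The product topology is the supremum of those induced by the projections, so convergence of the
     [M]-balls is checked coordinatewise. *)
  suff : F --> (x : prod_topology X) by move=> Fx /Fx [e e0 eA]; exists e.
  apply/cvg_sup => i; apply/cvg_image.
    by rewrite eqEsubset; split=> y // _; exists (dfwith x i y) => //; rewrite dfwithin.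
  move=> B /(nrm_nbhs (N i))[e e0 eB]; exists ((fun y : prod_topology X => y i) @^-1` B).
    exists e => // y /= ye; apply: eB; apply: le_lt_trans ye.
    exact: (M_comp (y - x)).
  rewrite eqEsubset; split=> [_ [y By <-]|z Bz]; first exact: By.
  by exists (dfwith x i z); rewrite /preimage /= dfwithin.
move=> [e e0 eA].
have near_i i : nbhs (x : prod_topology X) [set y | N i (y i - x i) < e / n.+1%:R].
  apply: (@proj_continuous _ (fun i => X i : topologicalType) i x
    [set z | N i (z - x i) < e / n.+1%:R]).
  by apply/(nrm_nbhs (N i)); exists (e / n.+1%:R) => //; rewrite divr_gt0.
have := filter_forall (nbhs_filter (x : prod_topology X)) near_i.
by apply: filterS => y ye; apply: eA; apply: M_lt.
Qed.

Let M_complete (u : nat -> Y) (c : R) :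
  (forall k, M (u k.+1 - u k) <= c * 2^-1 ^+ k) ->
  exists l, forall e, 0 < e -> exists m, forall k, (m <= k)%N -> M (u k - l) < e.
Proof.
move=> uc; have lim i : exists l, forall e, 0 < e ->
    exists m, forall k, (m <= k)%N -> N i (u k i - l) < e.
  apply: (@nrm_complete _ _ (N i) (fun k => u k i) c) => k.
  exact: le_trans (M_comp (u k.+1 - u k) i) (uc k).
pose l : Y := fun i => sval (cid (lim i)).
exists l => e e0; have e0' : 0 < e / n.+1%:R by rewrite divr_gt0.
have [m mP] := choice (fun i => svalP (cid (lim i)) _ e0').
exists (\max_i m i) => k mk; apply: M_lt => // i; apply: mP.
by rewrite (leq_trans _ mk)// leq_bigmax.
Qed.

(** Left transparent so that later bounds can compute with the sum of the component norms. *)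
Definition dsum_bnorm : bnorm Y.
Proof.
refine (@BNorm R Y M _ _ _ nbhs_M M_complete).
- by move=> x y; rewrite /M -big_split /=; apply: ler_sum => i _; exact: nrmD.
- by move=> a x; rewrite /M mulr_sumr; apply: eq_bigr => i _; exact: nrmZ.
- move=> x x0; apply: functional_extensionality_dep => i.
  apply: (nrm_eq0 (b := N i)); apply/eqP; rewrite eq_le nrm_ge0 andbT.
  by rewrite -x0 M_comp.
Defined.

End DirectSumNorm.

(** * Upper triangular operator matrices *)

Section UpperTriangular.
Variables (R : realType) (n : nat) (X : 'I_n.+1 -> preTopologicalLmodType R[i]).
Local Notation C := R[i].
Local Notation Y := (dsum X).

Definition dproj i (x : Y) : X i := x i.

Lemma dproj_linear i : linear (dproj i).
Proof. by []. Qed.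

HB.instance Definition _ i := GRing.isLinear.Build _ _ _ _ (dproj i) (@dproj_linear i).

Definition dinj i (x : X i) : Y := dfwith (fun j => 0 : X j) i x.

Lemma dinjK i x : dinj x i = x.
Proof. exact: dfwithin. Qed.

Lemma dinj_neq i (x : X i) j : j != i -> dinj x j = 0.
Proof. by move=> ji; rewrite /dinj dfwithout// eq_sym. Qed.

Lemma dinj_linear i : linear (@dinj i).
Proof.
move=> a x y; apply: functional_extensionality_dep => j.
rewrite -[RHS]/(a *: dinj x j + dinj y j).
have [->|ji] := eqVneq j i; first by rewrite !dinjK.
by rewrite !dinj_neq// scaler0 addr0.
Qed.

HB.instance Definition _ i := GRing.isLinear.Build _ _ _ _ (@dinj i) (@dinj_linear i).

Definition dmap (F : forall k, {linear X k -> X k}) (x : Y) : Y := fun k => F k (x k).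

Lemma dmap_linear F : linear (dmap F).
Proof.
by move=> a x y; apply: functional_extensionality_dep => k; exact: linearP.
Qed.

HB.instance Definition _ F := GRing.isLinear.Build _ _ _ _ (dmap F) (@dmap_linear F).

Definition supp_lt k (x : Y) := forall j : 'I_n.+1, (k <= j)%N -> x j = 0.

Variable N : forall i, bnorm (X i).
Local Notation M := (dsum_bnorm N).

Lemma dsumE (I : finType) (f : I -> Y) i : (\sum_k f k) i = \sum_k f k i.
Proof. exact: (linear_sum (dproj i)). Qed.

Lemma bounded_dproj i : bounded M (N i) (dproj i).
Proof.
exists 1 => // x; rewrite mul1r /= (bigD1 i)//= lerDl sumr_ge0// => j _.
exact: nrm_ge0.
Qed.

Lemma bounded_sum (V W : preTopologicalLmodType C) (L : bnorm V) (L' : bnorm W)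
    (I : finType) (P : pred I) (f : I -> V -> W) :
  (forall i, P i -> bounded L L' (f i)) -> bounded L L' (fun x => \sum_(i | P i) f i x).
Proof.
move=> bf; rewrite (_ : (fun x => _) = \sum_(i | P i) f i); last first.
  by apply/funext => x; rewrite fct_sumE.
by elim/big_ind: _ => //; [exact: bounded0|exact: bounded_add].
Qed.

Lemma bounded_dsum (V : preTopologicalLmodType C) (L : bnorm V) (f : V -> Y) :
  (forall i, bounded L (N i) (fun x => f x i)) -> bounded L M f.
Proof.
move=> bf; have /choice[c cP] : forall i, exists c, 0 <= c /\ forall x, N i (f x i) <= c * L x.
  by move=> i; have [c c0 cP] := bf i; exists c.
exists (\sum_i c i); first by apply: sumr_ge0 => i _; have [] := cP i.
by move=> x; rewrite mulr_suml; apply: ler_sum => i _; have [_] := cP i.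
Qed.

Lemma bounded_dinj i : bounded (N i) M (@dinj i).
Proof.
apply: bounded_dsum => j; have [->|ji] := eqVneq j i.
  exists 1 => // x; by rewrite dinjK mul1r.
by exists 0 => // x; rewrite dinj_neq// nrm0 mul0r.
Qed.

Variables (D : forall k, {linear X k -> X k}) (A : forall i j, {linear X j -> X i}).
Local Notation Tfun :=
  (upper_tri (fun k => (D k : X k -> X k)) (fun i j => (A i j : X j -> X i))).

Lemma upper_tri_linear : linear Tfun.
Proof.
move=> a x y; apply: functional_extensionality_dep => i.
rewrite /upper_tri -[RHS]/(a *: Tfun x i + Tfun y i) /upper_tri.
rewrite -[(a *: x + y) i]/(a *: x i + y i) linearP scalerDr addrACA; congr (_ + _).
rewrite scaler_sumr -big_split /=; apply: eq_bigr => j _.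
by rewrite -[(a *: x + y) j]/(a *: x j + y j) linearP.
Qed.

Definition upper_tri_op (x : Y) : Y := Tfun x.

HB.instance Definition _ := GRing.isLinear.Build _ _ _ _ upper_tri_op upper_tri_linear.
Local Notation T := upper_tri_op.

Lemma upper_triE x i : T x i = D i (x i) + \sum_(j < n.+1 | (i < j)%N) A i j (x j).
Proof. by []. Qed.

Lemma upper_tri_dinj (i j : 'I_n.+1) (x : X i) : (i <= j)%N -> T (dinj x) j = D j (dinj x j).
Proof.
move=> ij; rewrite upper_triE big1 ?addr0// => l jl.
rewrite dinj_neq ?linear0//; apply/eqP => li; move: jl.
by rewrite li ltnNge ij.
Qed.

(** For [v] in the kernel of [D k], the vector [T (dinj v)] is supported below [k], where [T] is
    onto up to finite codimension; hence suitable combinations of such [dinj v] can be corrected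
    below [k] to lie in the kernel of [T]. *)
Lemma upper_tri_infinite_ker (k : 'I_n.+1) :
  infinite_dim (null_space (D k)) ->
  (forall s : 'I_n.+1, (s < k)%N -> ~ infinite_codim (range (D s))) ->
  infinite_dim (null_space T).
Proof.
move=> iD cD.
(* Induction on [l]: coordinate [l] is removed using the finite codimension of the range of [D o],
   and the remainder is supported below [l]. *)
have span l : (l <= k)%N -> exists p (w : 'I_p -> Y), forall y, supp_lt l y ->
    exists (c : 'I_p -> C) x, supp_lt l x /\ y - \sum_i c i *: w i = T x.
  elim: l => [|l IH] lk.
    exists 0%N, (fun=> 0) => y y0; exists (fun=> 0), 0; split=> //.
    rewrite big_ord0 subr0 linear0.
    by apply: functional_extensionality_dep => j; exact: y0.
  have [p [w wP]] := IH (ltnW lk).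
  have ln : (l < n.+1)%N by rewrite (leq_trans lk)// ltnW.
  pose o := Ordinal ln.
  have [q [z zP]] := not_infinite_codim_span (lin_subspace_range (D o)) (cD o lk).
  exists (p + q)%N, (fun i => match fintype.split i with inl j => w j | inr j => dinj (z j) end).
  move=> y yl; have [c' [x0 _ x0E]] := zP (y o).
  have [|c [x1 [x1l x1E]]] := wP (y - \sum_i c' i *: dinj (z i) - T (dinj x0)).
    move=> j lj; rewrite -[LHS]/(y j - (\sum_i c' i *: dinj (z i)) j - T (dinj x0) j).
    have -> : (\sum_i c' i *: dinj (z i)) j = \sum_i c' i *: dinj (z i) j by rewrite dsumE.
    rewrite upper_tri_dinj//; have [->|jo] := eqVneq j o.
      by under eq_bigr do rewrite dinjK; rewrite dinjK -x0E subrr.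
    have -> : y j = 0.
      by apply: yl; rewrite ltn_neqAle lj andbT; apply: contra jo => /eqP e; apply/eqP/val_inj.
    rewrite dinj_neq// linear0 subr0 sub0r big1 ?oppr0// => i _.
    by rewrite dinj_neq// scaler0.
  exists (fun i => match fintype.split i with inl j => c j | inr j => c' j end), (dinj x0 + x1).
  split.
    move=> j lj; rewrite -[LHS]/(dinj x0 j + x1 j) x1l ?(ltnW lj)// addr0.
    by rewrite dinj_neq//; apply: contraL lj => /eqP ->; rewrite -leqNgt.
  rewrite [T (_ + _)]linearD /= -x1E [RHS]addrC [RHS]addrAC subrK big_split_ord /=.
  rewrite opprD addrA addrAC.
  congr (_ - _ - _); apply: eq_bigr => i _; first by rewrite (unsplitK (inr i)).
  by rewrite (unsplitK (inl i)).
move=> m; have [p [w wP]] := span k (leqnn k).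
have [v [vk vi]] := iD (m + p)%N.
have Tv j : supp_lt k (T (dinj (v j))).
  move=> l kl; rewrite upper_tri_dinj//; have [->|lk] := eqVneq l k.
    by rewrite dinjK; exact: vk.
  by rewrite dinj_neq ?linear0.
have /choice[cx cxP] : forall j, exists cx : ('I_p -> C) * Y,
    supp_lt k cx.2 /\ T (dinj (v j)) - \sum_i cx.1 i *: w i = T cx.2.
  by move=> j; have [c [x xP]] := wP _ (Tv j); exists (c, x).
(* The rows of [B] cancel the [p] coefficients along [w], which is why [m + p] kernel vectors were
   taken. *)
have [B [Bf Bc]] := exists_row_free_ker (\matrix_(j, i) (cx j).1 i : 'M[C]_(m + p, p)).
exists (fun l => \sum_j B l j *: (dinj (v j) - (cx j).2)); split.
  move=> l; rewrite /null_space /= linear_sum.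
  have TE j : T (B l j *: (dinj (v j) - (cx j).2)) = \sum_i (B l j * (cx j).1 i) *: w i.
    have [_ e] := cxP j; rewrite linearZ linearB /= -e subKr scaler_sumr.
    by apply: eq_bigr => i _; rewrite scalerA.
  rewrite (eq_bigr _ (fun j _ => TE j)) exchange_big big1// => i _.
  rewrite -scaler_suml; suff -> : \sum_j B l j * (cx j).1 i = 0 by rewrite scale0r.
  have /matrixP/(_ l i) := Bc; rewrite !mxE => e; rewrite -[RHS]e.
  by apply: eq_bigr => j _; rewrite mxE.
(* The corrections vanish in coordinate [k], so independence is inherited from the [v j]. *)
move=> a /(congr1 (dproj k)); rewrite linear0 linear_sum => az.
apply: (lin_indep_row_free Bf vi); rewrite -[RHS]az; apply: eq_bigr => l _.
rewrite [RHS]linearZ; congr (_ *: _); rewrite [RHS]linear_sum; apply: eq_bigr => j _.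
rewrite [RHS]linearZ; congr (_ *: _); rewrite [RHS]linearB /=.
have [/(_ k (leqnn k)) e _] := cxP j.
by rewrite /dproj dinjK e subr0.
Qed.

Hypothesis bD : forall k, bounded (N k) (N k) (D k).
Hypothesis bA : forall i j : 'I_n.+1, (i < j)%N -> bounded (N j) (N i) (A i j).

Lemma upper_tri_bounded : bounded M M T.
Proof.
apply: bounded_dsum => i; apply: bounded_add.
  exact: (bounded_comp (bD i) (bounded_dproj i)).
by apply: bounded_sum => j ij; exact: (bounded_comp (bA ij) (bounded_dproj j)).
Qed.

(** Since [T (dinj x) = dinj (D ord0 x)] in the first column, a left inverse of [T] relative to
    [dinj] gives one of [D ord0] after projection. *)
Lemma left_fredholm_upper_tri_corner : left_fredholm T -> left_fredholm (D ord0).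
Proof.
move=> lT.
have [S [F [bS fF SE]]] := left_fredholm_left_inverse upper_tri_bounded (bounded_dinj ord0) lT.
apply: (left_fredholm_of_left_inverse (bD ord0) (S := dproj ord0 \o S)
  (F := dproj ord0 \o (F \o @dinj ord0))).
- exact: (bounded_comp (bounded_dproj ord0) bS).
- apply: findim_sub (findim_image (dproj ord0) fF) => _ [x _ <-] /=.
  by exists (F (dinj x)) => //; exists (dinj x).
- move=> x; rewrite /= (SE _ (dinj x)).
    by rewrite -[LHS]/(dinj x ord0 - F (dinj x) ord0) dinjK.
  apply: functional_extensionality_dep => j; rewrite /= upper_tri_dinj//.
  have [->|j0] := eqVneq j ord0; first by rewrite !dinjK.
  by rewrite !dinj_neq// linear0.
Qed.

Lemma bounded_dmap (F : forall k, {linear X k -> X k}) :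
  (forall k, bounded (N k) (N k) (F k)) -> bounded M M (dmap F).
Proof.
by move=> bF; apply: bounded_dsum => i; exact: (bounded_comp (bF i) (bounded_dproj i)).
Qed.

Lemma findim_dmap (F : forall k, {linear X k -> X k}) :
  (forall k, findim (range (F k))) -> findim (range (dmap F)).
Proof.
move=> fF; rewrite (_ : dmap F = fun x : Y => \sum_k dinj (F k (x k))).
  apply: findim_range_sum => k; apply: findim_sub (findim_image (@dinj k) (fF k)).
  by move=> _ [x _ <-]; exists (F k (x k)).
apply/funext => x; apply: functional_extensionality_dep => k.
rewrite dsumE (bigD1 k)//= dinjK big1 ?addr0// => j jk.
by rewrite dinj_neq// eq_sym.
Qed.

Lemma left_fredholm_upper_tri : (forall k, left_fredholm (D k)) -> left_fredholm T.
Proof.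
move=> lD.
have exSF k : exists SF : {linear X k -> X k} * {linear X k -> X k},
    [/\ bounded (N k) (N k) SF.1, findim (range SF.2) &
        forall x, SF.1 (D k x) = x - SF.2 x].
  have [S [F [bS fF SE]]] :=
    left_fredholm_left_inverse (J := idfun) (bD k) (bounded_id (N k)) (lD k).
  by exists (S, F); split=> // x; exact: SE.
pose S k := (sval (cid (exSF k))).1; pose F k := (sval (cid (exSF k))).2.
have SF k : [/\ bounded (N k) (N k) (S k), findim (range (F k)) &
  forall x, S k (D k x) = x - F k x] := svalP (cid (exSF k)).
(* A strictly upper triangular operator satisfies [lowers 1]; the induction increases the shift
   until it exceeds every index. *)
pose lowers m (U : Y -> Y) := forall k x, supp_lt (k + m) x -> supp_lt k (U x).
(* A left inverse modulo finite rank and an operator [U] lowering supports is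
   improved by [(1 - U)], which replaces [U] by [- U ^ 2]. *)
have step m : exists S' F' U : {linear Y -> Y}, [/\ bounded M M S', findim (range F'),
    bounded M M U, lowers m.+1 U & forall x, S' (T x) = x - F' x + U x].
  elim: m => [|m [S' [F' [U [bS fF bU lU SE]]]]].
    exists (dmap S), (dmap F), (dmap S \o (T \- dmap D)).
    have bS : bounded M M (dmap S) by apply: bounded_dmap => k; have [] := SF k.
    split=> //.
    - by apply: findim_dmap => k; have [] := SF k.
    - apply: (bounded_comp bS); apply: bounded_sub; first exact: upper_tri_bounded.
      exact: bounded_dmap.
    - move=> k x xk j kj; rewrite /= -[LHS]/(S j (T x j - D j (x j))).
      rewrite upper_triE addrAC subrr add0r big1 ?linear0// => l jl.
      by rewrite xk ?linear0// addn1 (leq_ltn_trans kj).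
    - move=> x; rewrite /= linearB /=.
      have -> : dmap S (dmap D x) = x - dmap F x.
        by apply: functional_extensionality_dep => k; have [_ _ e] := SF k; exact: e.
      by rewrite addrC subrK.
  exists ((idfun \- U) \o S'), ((idfun \- U) \o F'), (\- (U \o U)); split.
  - by apply: bounded_comp bS; apply: bounded_sub => //; exact: bounded_id.
  - apply: findim_sub (findim_image (idfun \- U) fF) => _ [x _ <-].
    by exists (F' x); first by exists x.
  - have [c c0 cP] := bounded_comp bU bU.
    by exists c => // x; rewrite nrmN; exact: cP.
  (* Squaring doubles the shift, but one extra unit suffices for the induction. *)
  - move=> k x xk j kj; rewrite /= -[LHS]/(- (U (U x) j)).
    rewrite (lU k)// ?oppr0// => l kl.
    apply: (lU k.+1) => [i ki|]; first by apply: xk; rewrite addnS -addSn.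
    by rewrite (leq_trans _ kl)// addnS ltnS leq_addr.
  - move=> x; rewrite /= SE [U (_ + _)]linearD [U (_ - _)]linearB /=.
    rewrite !opprD !opprK addrA; congr (_ - _).
    by rewrite addrA addrK addrA.
(* There are [n.+1] summands, so [lowers n.+1] forces [U = 0]. *)
have [S' [F' [U [bS fF bU lU SE]]]] := step n.
apply: (left_fredholm_of_left_inverse upper_tri_bounded bS fF) => x.
rewrite SE; have -> : U x = 0; last by rewrite addr0.
apply: functional_extensionality_dep => j; apply: (lU 0%N) => // i.
by rewrite add0n leqNgt ltn_ord.
Qed.

End UpperTriangular.

(** * The operators shifted by [lam], and the identity of spectra *)

Lemma lam_minus_upper_tri (K : numFieldType) n (X : 'I_n -> preTopologicalLmodType K)
    (D : forall k, X k -> X k) (A : forall i j : 'I_n, X j -> X i) (lam : K) :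
  lam_minus (upper_tri D A) lam =
  upper_tri (fun k => lam_minus (D k) lam) (fun i j x => - A i j x).
Proof.
apply/funext => x; apply: functional_extensionality_dep => i.
by rewrite /upper_tri sumrN /lam_minus -addrA -opprD.
Qed.

(* Indices are 0-based: the paper's X_1,...,X_n are X 0, ..., X (n.+1),
   i.e. the paper's n is n.+2 here (so n >= 2 is built in). *)
Theorem mainTheorem6 (R : realType) (n : nat)
  (X : 'I_n.+2 -> completeNormedModType (R[i]))
  (D : forall k, {linear X k -> X k})
  (hD : forall k, continuous (D k : X k -> X k))
  (hcc : forall (s : 'I_n.+2) (lam : R[i]), (0 < s < n.+1)%N ->
           complements_condition (lam_minus (D s : X s -> X s) lam))
  (A : forall i j : 'I_n.+2, {linear X j -> X i})
  (hA : forall i j : 'I_n.+2, (i < j)%N -> continuous (A i j)) :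
  let d := fun k => (D k : X k -> X k) in
  let T := upper_tri (X := fun k => (X k : preTopologicalLmodType (R[i])))
             d (fun i j => (A i j : X j -> X i)) in
  let Delta1 : set (R[i]) :=
    \bigcup_(k in [set k : 'I_n.+2 | (0 < k)%N])
      [set lam | alpha_infinite (lam_minus (d k) lam) /\
                 (forall s : 'I_n.+2, (0 < s < k)%N -> alpha_finite (lam_minus (d s) lam)) /\
                 (exists s : 'I_n.+2, (s < k)%N /\ beta_infinite (lam_minus (d s) lam))]
    `&` ~` sigma_le (d ord0) in
  let Delta2 : set (R[i]) :=
    \bigcup_(k in [set: 'I_n.+2])
      [set lam | (forall s : 'I_n.+2, alpha_finite (lam_minus (d s) lam)) /\
                 ~ complemented (range (lam_minus (d k) lam))] in
  \bigcup_(k in [set: 'I_n.+2]) sigma_le (d k) =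
    sigma_le T `|` Delta1 `|` Delta2.
Proof.
move=> d T Delta1 Delta2.
pose Dl lam k : {linear X k -> X k} := (lam \*: idfun) \- D k.
pose Al i j : {linear X j -> X i} := \- A i j.
pose N k := normed_bnorm (X k).
have DE lam k : lam_minus (d k) lam = Dl lam k by [].
have TE lam : lam_minus T lam = upper_tri_op (Dl lam) Al.
  by rewrite /T lam_minus_upper_tri.
have bD lam k : bounded (N k) (N k) (Dl lam k).
  apply: bounded_sub; last exact: continuous_bounded (hD k).
  by exists (normc lam) => [|x]; rewrite ?normc_ge0// nrmZ.
have bA (i j : 'I_n.+2) : (i < j)%N -> bounded (N j) (N i) (Al i j).
  move=> ij; have [c c0 cP] := continuous_bounded (N j) (N i) (hA i j ij).
  by exists c => // x; rewrite nrmN; exact: cP.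
apply/seteqP; split=> lam.
  move=> [k _ nk]; apply: contrapT => nrhs.
  have lT : left_fredholm (upper_tri_op (Dl lam) Al).
    by rewrite -TE; apply: contrapT => nT; apply: nrhs; left; left.
  have lD0 : left_fredholm (lam_minus (d ord0) lam).
    exact: (left_fredholm_upper_tri_corner (bD lam) bA lT).
  (* If all the kernels were finite-dimensional, [D k] could only fail through its range, which
     would put [lam] in [Delta2]. *)
  have [s0 s0inf] : exists s, alpha_infinite (lam_minus (d s) lam).
    apply: contrapT => ninf; have fin s : alpha_finite (lam_minus (d s) lam).
      by move=> inf; apply: ninf; exists s.
    by apply: nrhs; right; exists k => //; split=> // ck; apply: nk; split; [exact: fin|exact: ck].
  (* The least index with an infinite-dimensional kernel witnesses [Delta1]; it is positive because
     [D ord0] is left Fredholm. *)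
  pose p i := `[< exists2 s : 'I_n.+2, i = s :> nat & alpha_infinite (lam_minus (d s) lam) >].
  have exp : exists i, p i by exists s0; apply/asboolP; exists s0.
  case: (ex_minnP exp) => m /asboolP[s -> sinf] smin.
  apply: nrhs; left; right; split; last by move=> nl; exact: nl.
  have s0' : (0 < s)%N.
    rewrite lt0n; apply/eqP => s0E; have [+ _] := lD0; apply.
    by rewrite (_ : ord0 = s) //; apply/val_inj.
  exists s => //; split=> //; split.
    move=> t /andP[_ ts] tinf; move: ts; rewrite ltnNge => /negP; apply.
    by apply: smin; apply/asboolP; exists t.
  (* If all earlier ranges had finite codimension, the kernel of the shifted [T] would be
     infinite-dimensional. *)
  apply: contrapT => nb; have [+ _] := lT; apply.
  apply: (@upper_tri_infinite_ker R n.+1 _ (Dl lam) Al s sinf) => // t ts tb; apply: nb.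
  by exists t.
(* Points of [Delta1] and [Delta2] exhibit a diagonal entry that is not left Fredholm; only
   [sigma_le T] needs the triangular argument. *)
move=> [[lamT|[[k _ [kinf _]] _]]|[k _ [_ nk]]].
- apply: contrapT => nk; apply: lamT; rewrite TE.
  apply: (left_fredholm_upper_tri (bD lam) bA) => k; apply: contrapT => nk'.
  by apply: nk; exists k.
- by exists k => //; case.
- by exists k => //; case.
Qed.
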